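(* Let $n\ge 4$ and $1\le p\le n-3$ be integers, let $m=\lfloor \frac{2n-p}{n-p}\rfloor$ and $t=2n-p-m(n-p)$, and let $f:[1,\infty)\to\mathbb{R}^+$ be a function such that $\log f$ is concave on $[2,\infty)$. Then for every unicyclic graph $G$ with $n$ vertices and exactly $p$ pendant vertices, $$ f(p+2)\, f(2)^{n-p-1} f(1)^p \le II_f(G) \le f(m+1)^t f(m)^{n-p-t} f(1)^p, $$ and both inequalities are attained (i.e., for each such $n,p,f$, each of the two bounds is equal to $II_f(G)$ for some unicyclic graph $G$ with $n$ vertices and $p$ pendant vertices).
   Context: All graphs are finite, connected, simple (no loops, no multiple edges) and have at least one edge. A unicyclic graph is a graph containing exactly one cycle. A vertex is pendant if it has degree $1$. For a vertex $u$ of $G$, $d_u$ denotes its degree. $\mathbb{R}^+$ denotes the positive real numbers. For a function $f:[1,\infty)\to\mathbb{R}^+$, $II_f(G) = \prod_{u\in V(G)} f(d_u)$. *)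

(* Defs.v *)
From mathcomp Require Import all_boot all_order all_algebra.
From mathcomp Require Import all_classical all_reals all_analysis.
Set Implicit Arguments.
Unset Strict Implicit.
Unset Printing Implicit Defensive.
Import Order.TTheory GRing.Theory Num.Theory.
Local Open Scope ring_scope.

Record graph := Graph {
  vertex :> finType;
  adj : rel vertex;
  adj_sym : symmetric adj;
  adj_irrefl : irreflexive adj;
  adj_connected : forall u v : vertex, connect adj u v;
  adj_nonempty : exists u v : vertex, adj u v
}.

Definition deg (G : graph) (u : G) : nat := #|[pred v | adj u v]|.

Definition num_pendant (G : graph) : nat := #|[pred u : G | deg u == 1]|.

(* [c] lists the vertices of a cycle in order. The same cycle has several such
   listings (rotations, reversal); they share the edge set [cycle_edges c],
   where an edge is an unordered pair of vertices, and distinct cycles have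
   distinct edge sets. Cycles are therefore counted by their edge sets. *)
Definition is_cycle (G : graph) (c : seq G) : bool :=
  [&& (2 < size c)%N, cycle (@adj G) c & uniq c].

Definition cycle_edges (G : graph) (c : seq G) : {set {set G}} :=
  [set [set u; next c u]%SET | u in c]%SET.

Definition unicyclic (G : graph) : Prop :=
  exists! E : {set {set G}}, exists2 c : seq G, is_cycle c & E = cycle_edges c.

Definition II (R : realType) (f : R -> R) (G : graph) : R :=
  \prod_(u : G) f (deg u)%:R.

Definition concave_function (R : realType) (D : set R) (g : R -> R) : Prop :=
  convex_function (D : set (convex_lmodType R^o)) (fun x => - g x).

(* Main.v *)
Require Import Defs.
From mathcomp Require Import all_boot all_order all_algebra.
From mathcomp Require Import all_classical all_reals all_analysis.
From mathcomp Require Import zify lra ring.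
Import Order.TTheory GRing.Theory Num.Theory.
Local Open Scope ring_scope.

(** In a unicyclic graph every edge but one joins a vertex to its parent in a
breadth-first spanning tree, so the degrees sum to [2n], and the [k = n - p]
non-pendant degrees are at least [2] and sum to [2k + p]. Compare [log f] on these
degrees with two affine functions: by concavity it lies above its chord over
[[2, p + 2]] and, at integers, below the line through its values at [m] and
[m + 1]. Summing an affine function only involves the sum of the degrees, which
gives both bounds. They are attained by a [k]-cycle with [p] pendant vertices,
hung from a single cycle vertex or distributed evenly modulo [k]. *)

(** * Indicator sums, unordered pairs and cyclic lists *)

Lemma sum_eq_nat (T : finType) (x : T) : (\sum_(y : T) (y == x) = 1)%N.
Proof. by rewrite (bigD1 x) //= eqxx big1 // => y /negbTE ->. Qed.

Lemma set2_inj (T : finType) (a b c d : T) : [set a; b]%SET = [set c; d]%SET ->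
  (a = c /\ b = d) \/ (a = d /\ b = c).
Proof.
move=> E.
have := set21 a b; rewrite E !inE => ac.
have := set22 a b; rewrite E !inE => bc.
have := set21 c d; rewrite -E !inE => ca.
have := set22 c d; rewrite -E !inE => da.
by case/orP: ac bc ca da => /eqP ? /orP[] /eqP ? /orP[] /eqP ? /orP[] /eqP ?; subst; auto.
Qed.

(** Otherwise two steps of [next] would return to [u]. Rotating [u] to the front shows that they
    lead to the third entry instead. *)
Lemma next_neq_prev (T : eqType) (c : seq T) (u : T) :
  uniq c -> (2 < size c)%N -> u \in c -> next c u != prev c u.
Proof.
move=> Uc sc uc; apply/eqP => E.
have := next_prev Uc u; rewrite -E.
case/rot_to: uc => i s Es.
rewrite -!(next_rot i Uc) Es.
have: uniq (u :: s) by rewrite -Es rot_uniq.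
have: (2 < size (u :: s))%N by rewrite -Es size_rot.
case: s {Es} => [|x [|y s]] //= _.
rewrite !inE !eqxx !negb_or -!andbA => /and5P[ux uy _ xy _].
by rewrite eq_sym (negbTE ux) => yu; rewrite yu eqxx in uy.
Qed.

(** * Spanning trees, fundamental cycles and the degree sum *)

Lemma deg_gt0 (G : graph) (u : G) : (0 < deg u)%N.
Proof.
have [x [y xy]] := adj_nonempty G.
have [w nwu] : exists w, w != u.
  have [xu|] := eqVneq x u; last by exists x.
  by exists y; apply: contraTneq xy => ->; rewrite xu adj_irrefl.
have /connectP[[|v s] /=] := adj_connected u w.
  by move=> _ E; rewrite E eqxx in nwu.
by case/andP=> uv _ _; apply/card_gt0P; exists v.
Qed.

(* [h] is the distance to [r] and [par] the parent in a breadth-first spanning tree. *)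
Lemma parent_exists (G : graph) (r : G) : exists (h : G -> nat) (par : G -> G),
  forall v, v != r -> adj v (par v) && (h (par v) < h v)%N.
Proof.
have ex v : exists k,
    `[< exists p, [/\ path (@adj G) r p, last r p = v & size p = k] >].
  have /connectP[p hp ->] := adj_connected r v.
  by exists (size p); apply/asboolP; exists p.
pose h v := ex_minn (ex v).
have hP v : exists p, [/\ path (@adj G) r p, last r p = v & size p = h v].
  by rewrite /h; case: ex_minnP => k /asboolP.
have hle p : path (@adj G) r p -> (h (last r p) <= size p)%N.
  move=> rp; rewrite /h; case: ex_minnP => k _; apply.
  by apply/asboolP; exists p.
(* The parent is the last vertex but one of a shortest path from [r]: dropping the last edge bounds
   its distance. At [r] the value is arbitrary. *)
have /choice[par Hpar] v : exists w, v != r -> adj v w && (h w < h v)%N.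
  have [->|nvr] := eqVneq v r; first by exists r.
  have [p []] := hP v; case/lastP: p => [_ E|p x]; first by rewrite -E eqxx in nvr.
  rewrite rcons_path last_rcons size_rcons => /andP[rp ax] xv <-; subst x.
  by exists (last r p) => _; rewrite adj_sym ax /= ltnS hle.
by exists h, par.
Qed.

(** A simple [T]-path from [x] to [y] is closed by the edge from [y] back to [x]; it has at least
    three vertices because [T x y] fails. The last clause says that the closing edge is the only one
    that can leave [T]. *)
Lemma fundamental_cycle (G : graph) (T : rel G) (x y : G) :
  subrel T (@adj G) -> connect T x y -> adj x y -> ~~ T x y ->
  exists c : seq G, [/\ is_cycle c, y \in c, next c y = x &
    forall w, w \in c -> T w (next c w) || ((w == y) && (next c w == x))].
Proof.
move=> TG /connectP[p0 Tp0 yE] axy nTxy.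
case: (shortenP Tp0) yE => p Tp Up _ yE {Tp0 p0}.
exists (x :: p); split.
- rewrite /is_cycle Up andbT; apply/andP; split.
    case: p Tp yE {Up} => [|a [|b s]] //= Tp yE; first by rewrite yE adj_irrefl in axy.
    by move: Tp nTxy; rewrite yE andbT => ->.
  by rewrite /= rcons_path (sub_path TG Tp) -yE adj_sym.
- by rewrite yE mem_last.
(* The index of the last vertex is past the end of [p], so [nth] returns its default, the head
   [x]. *)
- by rewrite next_nth yE mem_last index_last // nth_default.
- pose e w z := T w z || ((w == y) && (z == x)).
  have ce : cycle e (x :: p).
    rewrite /= rcons_path {2}/e -yE !eqxx orbT andbT.
    by apply: sub_path Tp => u v uv; rewrite /e uv.
  by move=> w wc; apply: (next_cycle ce wc).
Qed.

(** At a vertex of [c] where [h] is maximal, tree edges can only lead to the parent. If all edges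
    were tree edges, the successor and the predecessor of that vertex on [c] would coincide. *)
Lemma cycle_leaves_parent_tree (G : graph) (r : G) (h : G -> nat) (par : G -> G)
    (c : seq G) :
  (forall v, v != r -> (h (par v) < h v)%N) -> is_cycle c ->
  exists2 u, u \in c &
    ~~ (((u != r) && (next c u == par u)) || ((next c u != r) && (u == par (next c u)))).
Proof.
move=> hpar /and3P[sc _ Uc].
pose T u v := ((u != r) && (v == par u)) || ((v != r) && (u == par v)).
case: (boolP (has (fun u => ~~ T u (next c u)) c)) => [/hasP //|/hasPn nT].
have Tn u : u \in c -> T u (next c u) by move=> /nT; rewrite negbK.
have [u0 u0c] : exists u0, u0 \in c.
  by case: (c) sc => // a s _; exists a; rewrite mem_head.
case: (@arg_maxnP _ u0 (mem c) h u0c) => u uc umax.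
have up v : v \in c -> T u v || T v u -> v = par u.
  move=> /umax /= huv; rewrite /T => H.
  have {H}: ((u != r) && (v == par u)) || ((v != r) && (u == par v)).
    by case/orP: H => //; rewrite orbC.
  by case/orP=> /andP[nr /eqP E] //; have := hpar _ nr; rewrite -E; lia.
have := next_neq_prev _ _ _ Uc sc uc.
rewrite (up (next c u)) ?mem_next ?Tn // (up (prev c u)) ?eqxx ?mem_prev //.
by rewrite orbC -{2}(next_prev Uc u) Tn ?mem_prev.
Qed.

(* Two edges outside a spanning tree would lie on different fundamental cycles,
   and a cycle uses at least one such edge. *)
Lemma unicyclic_sum_deg (G : graph) : unicyclic G ->
  (\sum_(u : G) deg u = 2 * #|G|)%N.
Proof.
move=> [E [[c0 c0c _] Euniq]].
have [r _] := adj_nonempty G.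
have [h [par Hpar]] := parent_exists G r.
have hpar v : v != r -> (h (par v) < h v)%N by case/Hpar/andP.
pose T u v := ((u != r) && (v == par u)) || ((v != r) && (u == par v)).
have Tsym : symmetric T by move=> u v; rewrite /T orbC.
have TG : subrel T (@adj G).
  by move=> u v /orP[] /andP[/Hpar/andP[? _] /eqP ->] //; rewrite adj_sym.
have Tr v : connect T v r.
  have [k] := ubnP (h v); elim: k v => // k IH v hv.
  have [->|nvr] := eqVneq v r; first exact: connect0.
  apply: (connect_trans (y := par v)).
    by apply: connect1; rewrite /T nvr eqxx.
  by apply: IH; have := hpar _ nvr; lia.
have Tc u v : connect T u v.
  by apply: connect_trans (Tr u) _; rewrite (sym_connect_sym Tsym).
have [x [y [axy nTxy]]] : exists x y, adj x y /\ ~~ T x y.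
  have [u uc nT] := cycle_leaves_parent_tree _ _ _ _ _ hpar c0c.
  exists u, (next c0 u); split => //.
  by case/and3P: c0c => _ c0c _; exact: next_cycle c0c uc.
have [c [cc yc ncy nc]] := fundamental_cycle _ _ _ _ TG (Tc x y) axy nTxy.
(* The fundamental cycle of another non-tree edge has the same edge set as [c], so that edge lies on
   [c], whose only non-tree edge joins [x] and [y]. *)
have nontree u v : adj u v -> ~~ T u v -> (u = x /\ v = y) \/ (u = y /\ v = x).
  move=> auv nTuv.
  have [c' [cc' vc' ncv _]] := fundamental_cycle _ _ _ _ TG (Tc u v) auv nTuv.
  have : [set v; u]%SET \in cycle_edges c'.
    by apply/imsetP; exists v; rewrite ?ncv.
  have <- : cycle_edges c = cycle_edges c'.
    rewrite -(Euniq (cycle_edges c)); last by exists c.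
    by apply: Euniq; exists c'.
  case/imsetP => w wc Ew; case/orP: (nc w wc) => [Tw|/andP[/eqP wy /eqP nw]].
    by move: Tw nTuv; case: (set2_inj _ _ _ _ _ Ew) => -[<- <-]; rewrite 1?Tsym => ->.
  by case: (set2_inj _ _ _ _ _ Ew); rewrite nw wy => -[-> ->]; [left|right].
have nxy : x != y by apply: contraTneq axy => ->; rewrite adj_irrefl.
(* The four cases exclude each other, the first two because [h] cannot decrease both ways. Summed
   over [u] and [v] they contribute [n - 1], [n - 1], [1] and [1], where [n] is the number of
   vertices. *)
have adjE u v : nat_of_bool (adj u v) = (((u != r) && (v == par u)) +
    ((v != r) && (u == par v)) + ((u == x) && (v == y)) + ((u == y) && (v == x)))%N.
  have TE : nat_of_bool (T u v) =
      (((u != r) && (v == par u)) + ((v != r) && (u == par v)))%N.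
    rewrite /T; case: (boolP (u != r)) => //= ur; case: eqP => //= vE.
    case: (boolP (v != r)) => //= vr; case: eqP => //= uE.
    by have := hpar _ ur; have := hpar _ vr; rewrite -uE -vE; lia.
  rewrite -TE {TE}.
  have [/andP[/eqP -> /eqP ->]|nuv] := boolP ((u == x) && (v == y)).
    by rewrite axy (negbTE nTxy) (negbTE nxy).
  have [/andP[/eqP -> /eqP ->]|nvu] := boolP ((u == y) && (v == x)).
    by rewrite adj_sym axy Tsym (negbTE nTxy).
  rewrite !addn0; congr nat_of_bool; apply/idP/idP => [auv|/TG //].
  apply/negPn/negP => nT; case: (nontree _ _ auv nT) => -[uE vE].
    by rewrite uE vE !eqxx in nuv.
  by rewrite uE vE !eqxx in nvu.
have sum_and (b : bool) (a : G) : (\sum_(v : G) (b && (v == a)) = b)%N.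
  by case: b; rewrite /= ?sum_eq_nat // big1.
have sumr : (\sum_(v : G) (v != r) = #|G|.-1)%N.
  rewrite -(cardC1 r) -sum1_card [RHS]big_mkcond /=; apply: eq_bigr => v _.
  by rewrite inE; case: eqP.
have G0 : (0 < #|G|)%N by apply/card_gt0P; exists r.
have degE u : deg u = (\sum_(v : G) adj u v)%N.
  rewrite /deg -sum1_card big_mkcond; apply: eq_bigr => v _.
  by rewrite inE; case: adj.
have -> : (\sum_(u : G) deg u = \sum_(u : G) \sum_(v : G)
    (((u != r) && (v == par u)) + ((v != r) && (u == par v)) +
    ((u == x) && (v == y)) + ((u == y) && (v == x))))%N.
  by apply: eq_bigr => u _; rewrite degE; apply: eq_bigr => v _; rewrite adjE.
rewrite (eq_bigr (fun u => (u != r) + \sum_(v : G) ((v != r) && (u == par v))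
   + (u == x) + (u == y)))%N; last first.
  by move=> u _; rewrite !big_split /= !sum_and.
rewrite !big_split /= !sum_eq_nat sumr exchange_big /=.
rewrite [X in (_ + X + _ + _)%N](_ : _ = #|G|.-1); last first.
  by rewrite -sumr; apply: eq_bigr => u _; rewrite sum_and.
by move: G0; case: #|G| => //= k _; lia.
Qed.

(** * Chord inequalities for concave functions and their sums *)

(** Concavity at [y], a convex combination with weight [(z - y) / (z - x)] on [x]. Clearing the
    denominator lets the form cover [x = z]. *)
Lemma concave_chord (R : realType) (g : R -> R) (x y z : R) :
  concave_function `[2, +oo[%classic g -> 2 <= x -> x <= y -> y <= z ->
  (z - y) * g x + (y - x) * g z <= (z - x) * g y.
Proof.
move=> cg x2 xy yz.
have [xz|zx] := ltrP x z; last first.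
  have -> : y = x by lra.
  have -> : z = x by lra.
  by rewrite !subrr !mul0r addr0.
have zx0 : 0 < z - x by lra.
pose s := (z - y) / (z - x).
have s0 : 0 <= s by rewrite divr_ge0 //; lra.
have s1 : s <= 1 by rewrite ler_pdivrMr //; lra.
have := cg (@Itv01 R s s0 s1) x z.
rewrite !inE /= !in_itv /= !andbT => /(_ x2).
have z2 : 2 <= z by lra.
move=> /(_ z2).
have -> : conv (Itv01 s0 s1) (x : convex_lmodType R^o) z = y.
  by rewrite [LHS]convRE /= /unstable.onem /s; field; lra.
rewrite convRE /= /unstable.onem.
have -> : s * - g x + (1 - s) * - g z =
  - (((z - y) * g x + (y - x) * g z) / (z - x)) by rewrite /s; field; lra.
by rewrite lerN2 ler_pdivrMr // [g y * _]mulrC.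
Qed.

Section ConcaveSums.

Context {R : realType} {g : R -> R} {I : finType} {P : pred I} {d : I -> nat}.
Hypothesis g_concave : concave_function `[2, +oo[%classic g.
Hypothesis d_ge2 : forall i, P i -> (2 <= d i)%N.

Lemma sum_affine (a b c : R) :
  \sum_(i | P i) (a + b * ((d i)%:R - c)) =
  #|P|%:R * a + b * ((\sum_(i | P i) d i)%N%:R - #|P|%:R * c).
Proof.
by rewrite big_split /= sumr_const -mulr_sumr sumrB sumr_const natr_sum !mulr_natl.
Qed.

(* At integers [d >= 2] a concave function lies below the line through its values
   at [m] and [m + 1]. *)
Lemma concave_sum_le (m : nat) : (2 <= m)%N ->
  \sum_(i | P i) g (d i)%:R <= #|P|%:R * g m%:R +
    (g (m + 1)%:R - g m%:R) * ((\sum_(i | P i) d i)%N%:R - #|P|%:R * m%:R).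
Proof.
move=> m2; rewrite -sum_affine; apply: ler_sum => i Pi.
have di2 : 2 <= (d i)%:R :> R by rewrite ler_nat d_ge2.
have m2R : 2 <= m%:R :> R by rewrite ler_nat.
(* No integer lies strictly between [m] and [m + 1], so one of these two points lies between [d i]
   and the other. Concavity at that point bounds [g] at [d i] by the extrapolated line. *)
rewrite natrD; have [dm|md] := leqP (d i) m.
  have dmR : (d i)%:R <= m%:R :> R by rewrite ler_nat.
  have := concave_chord _ _ (d i)%:R m%:R (m%:R + 1) g_concave di2 dmR.
  have m1 : m%:R <= m%:R + 1 :> R by lra.
  by move=> /(_ m1); lra.
have mdR : m%:R + 1 <= (d i)%:R :> R by rewrite natr1 ler_nat.
have m1 : m%:R <= m%:R + 1 :> R by lra.
have := concave_chord _ _ m%:R (m%:R + 1) (d i)%:R g_concave m2R m1 mdR.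
by lra.
Qed.

(* On [[2, q + 2]] a concave function lies above its chord. *)
Lemma concave_sum_ge (q : nat) : (0 < q)%N ->
  (forall i, P i -> (d i <= q + 2)%N) ->
  #|P|%:R * g 2 + (g (q + 2)%:R - g 2) / q%:R *
    ((\sum_(i | P i) d i)%N%:R - #|P|%:R * 2) <= \sum_(i | P i) g (d i)%:R.
Proof.
move=> q0 dq; rewrite -sum_affine; apply: ler_sum => i Pi.
have di2 : 2 <= (d i)%:R :> R by rewrite ler_nat d_ge2.
have diq : (d i)%:R <= (q + 2)%:R :> R by rewrite ler_nat dq.
have q0R : 0 < q%:R :> R by rewrite ltr0n.
have := concave_chord _ _ 2 (d i)%:R (q + 2)%:R g_concave (lexx 2) di2 diq.
have -> : (q + 2)%:R - 2 = q%:R :> R by rewrite natrD addrK.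
rewrite [q%:R * _]mulrC -ler_pdivrMr //; apply: le_trans; rewrite le_eqVlt; apply/orP; left.
by apply/eqP; rewrite natrD; field; lra.
Qed.

End ConcaveSums.

(** * The cyclic successor and the counting of residues *)

Lemma iter_ordS (k n : nat) (i : 'I_k) : iter n (@ordS k) i = ((i + n) %% k)%N :> nat.
Proof.
elim: n => [|n IH]; first by rewrite addn0 modn_small.
by rewrite iterS /= IH -[in LHS]addn1 modnDml addn1 addnS.
Qed.

Lemma iter_ordS_onto (k : nat) (i j : 'I_k) : exists n, iter n (@ordS k) i = j.
Proof.
(* From [i], [k - i] steps wrap around to [0], and [j] more reach [j]. *)
exists (j + (k - i))%N; apply: ord_inj; rewrite iter_ordS.
have -> : (i + (j + (k - i)) = k + j)%N by have := ltn_ord i; lia.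
by rewrite modnDl modn_small.
Qed.

Lemma iter_ordS_neq (k n : nat) (i : 'I_k) : (0 < n < k)%N -> iter n (@ordS k) i != i.
Proof.
move=> nk; apply/eqP => /(congr1 (@nat_of_ord k)); rewrite iter_ordS.
have ik := ltn_ord i; have [ink|kin] := ltnP (i + n) k.
  by rewrite modn_small //; lia.
have -> : (i + n = k + (i + n - k))%N by lia.
by rewrite modnDl modn_small; lia.
Qed.

(** The numbers below [p] form [p %/ k] full blocks of residues and a partial block covering the
    residues below [p %% k]. *)
Lemma count_modn (k p i : nat) : (i < k)%N ->
  (\sum_(l < p) (l %% k == i) = p %/ k + (i < p %% k))%N.
Proof.
move=> ik; have k0 : (0 < k)%N by lia.
elim: p => [|p IH]; first by rewrite big_ord0 div0n mod0n.
rewrite big_ord_recr /= IH divnS // modnS.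
have pk := ltn_pmod p k0; case: ifP => kp; last by lia.
suff : (p %% k = k.-1)%N by lia.
have [lt|] := ltnP (p %% k).+1 k; last by lia.
by move: kp; rewrite /dvdn -addn1 -modnDml addn1 modn_small.
Qed.

(** * The extremal graphs: a cycle with pendant vertices attached *)

Section Sun.

Context {k p : nat}.
Hypothesis k_gt2 : (2 < k)%N.
Variable a : 'I_p -> 'I_k.

(* A [k]-cycle with [p] pendant vertices, the [l]-th of which hangs from [a l]. *)
Definition sun_adj (u v : 'I_k + 'I_p) : bool :=
  match u, v with
  | inl i, inl j => (j == ordS i) || (i == ordS j)
  | inl i, inr l | inr l, inl i => i == a l
  | inr _, inr _ => false
  end.

Lemma sun_adj_sym : symmetric sun_adj.
Proof. by move=> [i|l] [j|l'] //=; rewrite orbC. Qed.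

Lemma sun_adj_irrefl : irreflexive sun_adj.
Proof. by move=> [i|l] //=; rewrite orbb eq_sym; apply/negbTE/(iter_ordS_neq _ 1); lia. Qed.

Lemma sun_adj_connected u v : connect sun_adj u v.
Proof.
have cycle_conn i j : connect sun_adj (inl i) (inl j).
  have [n <-] := iter_ordS_onto _ i j; elim: n => [|n IH]; first exact: connect0.
  by apply: connect_trans IH (connect1 _); rewrite iterS /= eqxx.
have to_cycle w : exists i, connect sun_adj w (inl i).
  case: w => [i|l]; first by exists i; apply: connect0.
  by exists (a l); apply: connect1 => /=.
have [i ui] := to_cycle u; have [j vj] := to_cycle v.
apply: connect_trans ui _; apply: connect_trans (cycle_conn i j) _.
by rewrite (sym_connect_sym sun_adj_sym).
Qed.

Lemma sun_adj_nonempty : exists u v, sun_adj u v.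
Proof.
have k0 : (0 < k)%N by lia.
by exists (inl (Ordinal k0)), (inl (ordS (Ordinal k0))); rewrite /= eqxx.
Qed.

Definition sun : graph :=
  Graph sun_adj_sym sun_adj_irrefl sun_adj_connected sun_adj_nonempty.

Lemma card_sun : #|sun| = (k + p)%N.
Proof. by rewrite card_sum !card_ord. Qed.

Lemma sun_degE (u : sun) :
  deg u = (\sum_(j < k) sun_adj u (inl j) + \sum_(l < p) sun_adj u (inr l))%N.
Proof.
rewrite /deg -sum1_card big_mkcond /= big_sumType /=.
by congr (_ + _)%N; apply: eq_bigr => j _; rewrite inE /=; case: sun_adj.
Qed.

Lemma ordS_pred_eq (i j : 'I_k) : (i == ordS j) = (j == ord_pred i).
Proof. by rewrite eq_sym (can2_eq (@ordSK k) (@ord_predK k)). Qed.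

Lemma sun_deg_inl (i : 'I_k) :
  deg (inl i : sun) = (2 + \sum_(l < p) (i == a l))%N.
Proof.
rewrite sun_degE /=; congr (_ + _)%N.
(* The successor and the predecessor of [i] differ because [k > 2], so the disjunction becomes a sum
   of indicators. *)
rewrite (eq_bigr (fun j => (j == ordS i) + (j == ord_pred i)))%N.
  by rewrite big_split /= !sum_eq_nat.
move=> j _; rewrite (ordS_pred_eq i j).
have [->|_] := eqVneq j (ordS i); last by [].
rewrite [_ == ord_pred i](_ : _ = false) //.
by apply/eqP => /(congr1 (@ordS k)); rewrite ord_predK; exact/eqP/(iter_ordS_neq _ 2).
Qed.

Lemma sun_deg_inr (l : 'I_p) : deg (inr l : sun) = 1%N.
Proof. by rewrite sun_degE /= sum_eq_nat big1. Qed.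

Lemma sun_num_pendant : num_pendant sun = p.
Proof.
rewrite /num_pendant -sum1_card big_mkcond /= big_sumType /=.
rewrite big1 => [|i _]; last by rewrite inE sun_deg_inl.
under eq_bigr => l _ do rewrite inE sun_deg_inr eqxx.
by rewrite sum1_card card_ord.
Qed.

Lemma II_sun (R : realType) (f : R -> R) :
  II f sun = \prod_(i < k) f (2 + \sum_(l < p) (i == a l))%N%:R * f 1 ^+ p.
Proof.
rewrite /II big_sumType /=; congr (_ * _).
  by apply: eq_bigr => i _; rewrite sun_deg_inl.
rewrite (eq_bigr (fun=> f 1)) => [|l _]; last by rewrite sun_deg_inr.
by rewrite prodr_const card_ord.
Qed.

(** A pendant vertex has a single neighbour, which would be both its successor and its predecessor
    on the cycle. *)
Lemma sun_cycle_inl (c : seq sun) (u : sun) : is_cycle c -> u \in c ->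
  exists i, u = inl i.
Proof.
move=> /and3P[sc cc Uc] uc; case: u uc => [i|l] uc; first by exists i.
have nbr v : sun_adj (inr l) v -> v = inl (a l) by case: v => //= i /eqP ->.
have := next_neq_prev _ _ _ Uc sc uc.
rewrite (nbr _ (next_cycle cc uc)) (nbr (prev c (inr l))) ?eqxx //.
by rewrite sun_adj_sym; apply: prev_cycle cc uc.
Qed.

Lemma sun_cycle_adj (c : seq sun) (i : 'I_k) (v : sun) : is_cycle c -> v \in c ->
  adj (inl i : sun) v -> v = inl (ordS i) \/ v = inl (ord_pred i).
Proof.
move=> cc vc; have [j ->] := sun_cycle_inl _ _ cc vc.
by rewrite /= (ordS_pred_eq i j) => /orP[] /eqP ->; [left|right].
Qed.

(** The two neighbours of [inl i] on [c] are distinct and lie among [inl (ordS i)] and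
    [inl (ord_pred i)], so one of them is [inl (ordS i)]. The disjunction records the direction of
    traversal. *)
Lemma sun_cycle_next (c : seq sun) (i : 'I_k) : is_cycle c -> inl i \in c ->
  inl (ordS i) \in c /\
  (next c (inl i) = inl (ordS i) \/ next c (inl (ordS i)) = inl i).
Proof.
move=> c_cyc ic; case/and3P: (c_cyc) => sc cc Uc.
have nc : next c (inl i) \in c by rewrite mem_next.
have pc : prev c (inl i) \in c by rewrite mem_prev.
have np := next_prev Uc (inl i).
have neq := next_neq_prev _ _ _ Uc sc ic.
have pa : adj (inl i : sun) (prev c (inl i)) by rewrite adj_sym; apply: prev_cycle cc ic.
have [ni|ni] := sun_cycle_adj _ _ _ c_cyc nc (next_cycle cc ic).
  by rewrite -{1}ni; split => //; left.
have [pi|pi] := sun_cycle_adj _ _ _ c_cyc pc pa.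
  by rewrite -pi; split => //; right.
by rewrite ni pi eqxx in neq.
Qed.

(** Closure under the successor puts every [inl i] on [c]. As the right-hand side does not mention
    [c], this yields uniqueness of the cycle. *)
Lemma sun_cycle_edges (c : seq sun) : is_cycle c ->
  cycle_edges c = [set [set (inl i : sun); inl (ordS i)] | i : 'I_k]%SET.
Proof.
move=> c_cyc; case/and3P: (c_cyc) => sc cc Uc.
have [i0 i0c] : exists i, inl i \in c.
  case: (c) sc c_cyc => // u s _ us.
  by have [i ui] := sun_cycle_inl _ _ us (mem_head u s); exists i; rewrite -ui mem_head.
have allc i : inl i \in c.
  have [n <-] := iter_ordS_onto _ i0 i; elim: n => //= n IH.
  by have [] := sun_cycle_next _ _ c_cyc IH.
apply/setP => E; apply/imsetP/imsetP => [[u uc ->]|[i _ ->]].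
  have nuc : next c u \in c by rewrite mem_next.
  have [i ui] := sun_cycle_inl _ _ c_cyc uc; move: uc nuc; rewrite ui => uc nuc.
  have [->|->] := sun_cycle_adj _ _ _ c_cyc nuc (next_cycle cc uc); first by exists i.
  by exists (ord_pred i); rewrite // ord_predK finset.setUC.
have [_ [ni|ni]] := sun_cycle_next _ _ c_cyc (allc i).
  by exists (inl i); rewrite ?ni.
by exists (inl (ordS i)); rewrite ?ni 1?finset.setUC.
Qed.

Lemma sun_unicyclic : unicyclic sun.
Proof.
have k0 : (0 < k)%N by lia.
pose x := Ordinal k0; pose c : seq sun := map inl (orbit (@ordS k) x).
have cc : is_cycle c.
  apply/and3P; split.
  - rewrite size_map.
    (* The orbit has more than two elements because it contains these three distinct ones. *)
    apply: (@uniq_leq_size _ [:: x; ordS x; ordS (ordS x)]) => [|y].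
      have S1 : x != ordS x by rewrite eq_sym; apply: (iter_ordS_neq _ 1); lia.
      have S2 : x != ordS (ordS x) by rewrite eq_sym; apply: (iter_ordS_neq _ 2).
      have S12 : ordS x != ordS (ordS x) by rewrite eq_sym; apply: (iter_ordS_neq _ 1); lia.
      by rewrite /= !inE negb_or S1 S2 S12.
    rewrite !inE -fconnect_orbit => /or3P[] /eqP ->.
    - exact: connect0.
    - exact: fconnect1.
    - exact: fconnect_iter _ 2 x.
  - rewrite cycle_map; apply: sub_cycle (cycle_orbit (@ordS_inj k) x).
    by move=> i j /eqP <-; rewrite /= eqxx.
  - by rewrite map_inj_uniq ?orbit_uniq // => i j [].
exists (cycle_edges c); split; first by exists c.
by move=> E [c' cc' ->]; rewrite !sun_cycle_edges.
Qed.

End Sun.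

(** * Reduction to the non-pendant vertices, and the two bounds *)

Lemma nonpendant_degrees (G : graph) : unicyclic G ->
  (#|[pred u : G | deg u != 1%N]| + num_pendant G = #|G|)%N /\
  (\sum_(u : G | deg u != 1%N) deg u + num_pendant G = 2 * #|G|)%N.
Proof.
move=> /unicyclic_sum_deg sG; split.
  by rewrite addnC -(cardC [pred u : G | deg u == 1%N]).
rewrite -sG [RHS](bigID [pred u : G | deg u == 1%N]) /= addnC; congr (_ + _)%N.
by rewrite /num_pendant -sum1_card; apply: eq_bigr => u /eqP ->.
Qed.

Lemma II_split_pendant (R : realType) (f : R -> R) (G : graph) :
  II f G = \prod_(u : G | deg u != 1%N) f (deg u)%:R * f 1 ^+ num_pendant G.
Proof.
rewrite /II (bigID [pred u : G | deg u == 1%N]) /= mulrC; congr (_ * _).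
rewrite (eq_bigr (fun=> f 1)) => [|u /eqP -> //].
by rewrite prodr_const.
Qed.

Lemma ln_prod (R : realType) (I : finType) (P : pred I) (F : I -> R) :
  (forall i, P i -> 0 < F i) -> ln (\prod_(i | P i) F i) = \sum_(i | P i) ln (F i).
Proof.
move=> F0; rewrite -[RHS]expRK expR_sum; congr ln.
by apply: eq_bigr => i Pi; rewrite lnK // posrE F0.
Qed.

(** Evaluates the product for evenly distributed pendant vertices, where the first [r] cycle
    vertices carry one more than the others. *)
Lemma prod_threshold (R : realType) (k r : nat) (A B : R) : (r <= k)%N ->
  \prod_(i < k) (if (i < r)%N then A else B) = A ^+ r * B ^+ (k - r).
Proof.
move=> rk; rewrite -(big_mkord xpredT (fun i => if (i < r)%N then A else B)).
rewrite (big_cat_nat _ (n := r)) //=; congr (_ * _).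
  by rewrite big_mkord (eq_bigr (fun=> A)) => [|i _]; rewrite ?prodr_const ?card_ord ?ltn_ord.
rewrite (eq_big_nat _ _ (F2 := fun=> B)) => [|i /andP[ri _]].
  by rewrite prodr_const_nat.
by rewrite ltnNge ri.
Qed.

Theorem theorem5p5 (R : realType) (n p m t : nat) (f : R -> R)
    (hn : (4 <= n)%N) (hp : (1 <= p <= n - 3)%N)
    (hm : m = ((2 * n - p) %/ (n - p))%N)
    (ht : t = (2 * n - p - m * (n - p))%N)
    (f_pos : forall x : R, 1 <= x -> 0 < f x)
    (f_concave : concave_function `[2, +oo[%classic (fun x => ln (f x))) :
  let lower := f (p + 2)%:R * f 2 ^+ (n - p - 1) * f 1 ^+ p in
  let upper := f (m + 1)%:R ^+ t * f m%:R ^+ (n - p - t) * f 1 ^+ p in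
  [/\ forall G : graph, unicyclic G -> #|G| = n -> num_pendant G = p ->
        lower <= II f G <= upper,
      exists G : graph,
        [/\ unicyclic G, #|G| = n, num_pendant G = p & II f G = lower]
    & exists G : graph,
        [/\ unicyclic G, #|G| = n, num_pendant G = p & II f G = upper]].
Proof.
move=> lower upper; have /andP[p0 pn] := hp.
have fn0 d : (0 < d)%N -> 0 < f d%:R by move=> d0; rewrite f_pos // ler1n.
rewrite /lower /upper {lower upper}.
have [k nE k3] : exists2 k, n = (k + p)%N & (2 < k)%N.
  by exists (n - p)%N; lia.
have nk : (n - p = k)%N by lia.
(* Since [2 * n - p = 2 * k + p], dividing by [k] gives quotient [2 + p %/ k] and remainder
   [p %% k]. *)
have mE : m = (2 + p %/ k)%N.
  by rewrite hm nk (_ : 2 * n - p = 2 * k + p)%N ?divnMDl; lia.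
have tE : t = (p %% k)%N.
  by rewrite ht mE nk nE mulnDl; have := divn_eq p k; lia.
rewrite nk => {hn hp pn hm ht}; have tk : (t < k)%N by rewrite tE ltn_pmod //; lia.
split.
- move=> G uG cG pG; have [cP sP] := nonpendant_degrees _ uG.
  rewrite II_split_pendant pG.
  have cP' : #|[pred u : G | deg u != 1%N]| = k by move: cP; rewrite cG pG nE => /addIn.
  have sP' : (\sum_(u : G | deg u != 1%N) deg u = 2 * k + p)%N.
    by move: sP; rewrite cG pG nE; lia.
  have d2 (u : G) : deg u != 1%N -> (2 <= deg u)%N by have := deg_gt0 _ u; lia.
  (* The other [k - 1] non-pendant degrees are at least [2], which leaves at most
     [2 * k + p - 2 * (k - 1) = p + 2] for [u]. *)
  have dp2 (u : G) : deg u != 1%N -> (deg u <= p + 2)%N.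
    move=> du; move: cP' sP'; rewrite (bigD1 u) //= (cardD1 u) inE du /= => cP' sP'.
    have : (\sum_(v : G | (deg v != 1%N) && (v != u)) 2 <=
        \sum_(v : G | (deg v != 1%N) && (v != u)) deg v)%N.
      by apply: leq_sum => v /andP[/d2].
    rewrite sum_nat_const (_ : #|_| = k.-1) //; first by lia.
    rewrite -cP'; apply: eq_card => v; rewrite !inE andbC //.
  have prod0 : 0 < \prod_(u : G | deg u != 1%N) f (deg u)%:R.
    by apply: prodr_gt0 => u _; rewrite fn0 ?deg_gt0.
  have lnprod : ln (\prod_(u : G | deg u != 1%N) f (deg u)%:R) =
      \sum_(u : G | deg u != 1%N) ln (f (deg u)%:R).
    by rewrite ln_prod // => u _; rewrite fn0 ?deg_gt0.
  have f10 : 0 < f 1 by exact: f_pos.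
  have f20 : 0 < f 2 by rewrite f_pos // ler1n.
  have fp0 : 0 < f (p + 2)%:R by rewrite fn0 // addn2.
  have fm0 : 0 < f m%:R by rewrite fn0 // mE.
  have fm10 : 0 < f (m + 1)%:R by rewrite fn0 // addn1.
  rewrite !ler_pM2r ?exprn_gt0 //; apply/andP; split.
    rewrite -ler_ln ?posrE ?mulr_gt0 ?exprn_gt0 // lnM ?posrE ?exprn_gt0 // lnXn // lnprod.
    (* The degree sum exceeds [2 * k] by exactly [p], cancelling the denominator of the slope: the
       chord bound equals the logarithm of the lower bound. *)
    apply: le_trans (concave_sum_ge f_concave d2 p p0 dp2).
    rewrite sP' cP' [(2 * k + p)%N%:R]natrD natrM -[ln (f 2) *+ _]mulr_natl natrB; last by lia.
    have pR0 : p%:R != 0 :> R by rewrite pnatr_eq0; lia.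
    move: (ln (f 2)) (ln (f (p + 2)%:R)) (k%:R : R) (p%:R : R) pR0 => a b c q q0.
    rewrite le_eqVlt; apply/orP; left; apply/eqP; by field.
  rewrite -ler_ln ?posrE ?mulr_gt0 ?exprn_gt0 // lnM ?posrE ?exprn_gt0 // !lnXn // lnprod.
  apply: le_trans (concave_sum_le f_concave d2 m _) _; first by rewrite mE.
  (* The degree sum exceeds [m * k] by exactly [t], so the line through [m] and [m + 1] gives weight
     [t] to [m + 1] and [k - t] to [m]. *)
  have tR : (2 * k + p)%N%:R = (m * k)%N%:R + t%:R :> R.
    by rewrite -natrD; congr (_%:R); rewrite tE mE {1}(divn_eq p k); lia.
  rewrite sP' cP' tR natrM -[ln (f m%:R) *+ _]mulr_natl.
  rewrite -[ln (f (m + 1)%:R) *+ _]mulr_natl natrB; last exact: ltnW.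
  move: (ln (f m%:R)) (ln (f (m + 1)%:R)) (k%:R : R) (m%:R : R) (t%:R : R) => a b c q q'.
  by rewrite le_eqVlt; apply/orP; left; apply/eqP; ring.
- have k0 : (0 < k)%N by lia.
  (* All pendant vertices hang from vertex [0], of degree [p + 2]; the other cycle vertices keep
     degree [2]. *)
  exists (sun k3 (fun _ : 'I_p => Ordinal k0)); split.
  + exact: sun_unicyclic.
  + by rewrite card_sun nE.
  + exact: sun_num_pendant.
  rewrite II_sun; congr (_ * _); rewrite (bigD1 (Ordinal k0)) //=; congr (_ * _).
    by rewrite sum_nat_const card_ord muln1 addnC.
  rewrite (eq_bigr (fun=> f 2)) => [|i /negbTE ni].
    by rewrite prodr_const cardC1 card_ord subn1.
  by rewrite big1 ?addn0 // => l _; rewrite ni.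
- have k0 : (0 < k)%N by lia.
  (* With the [l]-th pendant vertex at [l %% k], the first [t] cycle vertices have degree [m + 1]
     and the others [m]. *)
  exists (sun k3 (fun l : 'I_p => Ordinal (ltn_pmod l k0))); split.
  + exact: sun_unicyclic.
  + by rewrite card_sun nE.
  + exact: sun_num_pendant.
  rewrite II_sun -prod_threshold ?(ltnW tk) //; congr (_ * _); apply: eq_bigr => i _.
  rewrite (eq_bigr (fun l : 'I_p => nat_of_bool (l %% k == i)%N)) => [|l _]; last first.
    by rewrite eq_sym.
  by rewrite count_modn // addnA -mE -tE; case: ifP; rewrite ?addn0.
Qed.
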